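(* Let $p_1<p_2$ be finite real numbers, let $I$ be an open interval containing $[p_1,p_2]$, and let $\mu\in(0,1]$. Suppose that $U:(p_1,p_2]\to\mathbb{C}$ satisfies Assumption (A$_{p_1,\mu}$) with regular factor $\tilde u$ (see context). Moreover suppose that $\psi:I\to\mathbb{R}$ belongs to $\mathcal{C}^2([p_1,p_2])$, and that $\psi'$ does not vanish and is monotone on $[p_1,p_2]$. Then for all $\omega>0$, $$\left|\int_{p_1}^{p_2}U(p)\,e^{i\omega\psi(p)}\,dp\right|\leqslant C_c(U,\psi)\,\omega^{-\mu},$$ where $$C_c(U,\psi):=\frac1\mu\,\|\tilde u\|_{L^\infty(p_1,p_2)}+\left(4\,\|\tilde u\|_{L^\infty(p_1,p_2)}+\|\tilde u'\|_{L^1(p_1,p_2)}\right)\left(\min_{p\in[p_1,p_2]}|\psi'(p)|\right)^{-1}.$$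
   Context: Assumption (A$_{p_1,\mu}$) (with $\mu\in(0,1]$): for $U:(p_1,p_2]\to\mathbb{C}$ there exists $\tilde u:[p_1,p_2]\to\mathbb{C}$ such that $U(p)=(p-p_1)^{\mu-1}\,\tilde u(p)$ for all $p\in(p_1,p_2]$, where $\tilde u$ is continuous on $[p_1,p_2]$, differentiable on $(p_1,p_2)$ with $\tilde u'\in L^1(p_1,p_2)$, and $\tilde u(p_1)\neq0$ if $\mu\neq1$. The function $\tilde u$ is called the regular factor of $U$. *)

(* Defs.v *)
From HB Require Import structures.
From mathcomp Require Import all_boot all_order all_algebra.
From mathcomp Require Import complex.
From mathcomp Require Import all_classical all_reals all_analysis.
Set Implicit Arguments.
Unset Strict Implicit.
Unset Printing Implicit Defensive.
Import Order.TTheory GRing.Theory Num.Theory.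
Import numFieldNormedType.Exports.
Local Open Scope classical_set_scope.
Local Open Scope ring_scope.

(* The complex numbers as a normed module over R. [Rcomplex R] comes with the
   field structure of R[i] and the R-valued modulus as norm; the topology added
   here is the one of that norm, so that [continuous], [derivable] and [derive1]
   apply to functions R -> C. *)
Section Rcomplex_normedModType.
Variable R : realType.

Lemma Rcomplex_normrZ (l : R) (z : Rcomplex R) : `|l *: z| = `|l| * `|z|.
Proof.
case: z => a b; rewrite /Num.norm /= !exprMn -mulrDr.
by rewrite sqrtrM ?sqr_ge0// sqrtr_sqr.
Qed.

HB.instance Definition _ :=
  PseudoMetric.copy (Rcomplex R) (pseudoMetric_normed (Rcomplex R)).
HB.instance Definition _ := isPointed.Build (Rcomplex R) 0.
HB.instance Definition _ :=
  NormedZmod_PseudoMetric_eq.Build R (Rcomplex R) erefl.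
HB.instance Definition _ :=
  PseudoMetricNormedZmod_Lmodule_isNormedModule.Build R (Rcomplex R)
    Rcomplex_normrZ.

End Rcomplex_normedModType.

Section definitions.
Variable R : realType.
Local Notation C := (Rcomplex R).
Local Notation leb := (@lebesgue_measure R).

Definition expi (t : R) : C := Complex (cos t) (sin t).

Definition cintegrable (D : set R) (f : R -> C) : Prop :=
  leb.-integrable D (fun x => (complex.Re (f x))%:E) /\
  leb.-integrable D (fun x => (complex.Im (f x))%:E).

Definition cintegral (D : set R) (f : R -> C) : C :=
  Complex (\int[leb]_(x in D) complex.Re (f x)) (\int[leb]_(x in D) complex.Im (f x)).

(* [f] is extended by 0 outside [D], which does not change the norm. *)
Definition cLnorm (p : \bar R) (D : set R) (f : R -> C) : \bar R :=
  'N[leb]_p[(fun x => `|f x|%:E) \_ D]%E.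

(* Derivative relative to [A]: one-sided at the endpoints of a segment. *)
Definition derivable_within (A : set R) (f : R -> R) (x : R) : Prop :=
  cvg ((f y - f x) / (y - x) @[y --> within A x^']).

Definition derive_within (A : set R) (f : R -> R) (x : R) : R :=
  lim ((f y - f x) / (y - x) @[y --> within A x^']).

Definition class_C (k : nat) (A : set R) (f : R -> R) : Prop :=
  (forall j x, (j < k)%N -> A x ->
     derivable_within A (iter j (derive_within A) f) x) /\
  (forall j, (j <= k)%N ->
     {within A, continuous (iter j (derive_within A) f)}).

Definition monotone_on (A : set R) (f : R -> R) : Prop :=
  {in A &, {homo f : x y / x <= y}} \/ {in A &, {homo f : x y /~ x <= y}}.

(* Junk value 0 when [A] has no least element. *)
Definition set_min (A : set R) : R := xget 0 (A `&` lbound A).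

(* Values of [U] outside ]p1, p2] and of [u] outside [p1, p2] are irrelevant. *)
Definition regular_factor (p1 p2 mu : R) (U u : R -> C) : Prop :=
  [/\ forall p, p \in `]p1, p2] -> U p = (p - p1) `^ (mu - 1) *: u p,
      {within `[p1, p2], continuous u},
      forall p, p \in `]p1, p2[ -> derivable u p 1,
      cintegrable `]p1, p2[ (derive1 u) &
      mu != 1 -> u p1 != 0].

Definition Cc (p1 p2 mu : R) (u : R -> C) (psi : R -> R) : \bar R :=
  let normu := cLnorm +oo `]p1, p2[ u in
  let normdu := cLnorm 1 `]p1, p2[ (derive1 u) in
  let dpsi := derive_within `[p1, p2] psi in
  let m := set_min [set `|dpsi p| | p in `[p1, p2]] in
  ((mu^-1)%:E * normu + (4%:E * normu + normdu) * (m^-1)%:E)%E.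

End definitions.

(* Main.v *)
Require Import Defs.
From mathcomp Require Import all_boot all_order all_algebra.
From mathcomp Require Import complex.
From mathcomp Require Import lra ring.
From mathcomp Require Import all_classical all_reals all_analysis.
From mathcomp Require Import measurable_realfun ess_sup_inf.
Import Order.TTheory GRing.Theory Num.Theory.
Import numFieldNormedType.Exports.
Local Open Scope classical_set_scope.
Local Open Scope ring_scope.

Local Notation leb := lebesgue_measure.
Local Notation Re := complex.Re.
Local Notation Im := complex.Im.

(** The range of integration is cut at distance [1 / omega] from the singular
    point [p1].  On the short piece next to [p1] the oscillation is ignored and
    the weight [(p - p1) `^ (mu - 1)] is integrated exactly, which gives the
    term [|u| / mu].  If the whole segment is shorter than [1 / omega], this
    piece is everything.

    On the rest the weight is at most [W = omega `^ (1 - mu)], and the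
    first-derivative test of van der Corput applies
    ([oscillatory_Rintegral_le]): dividing by [psi'] makes the integrand the
    derivative of [weight * u / (i omega psi') * e^(i omega psi)] up to terms in
    the derivative of the amplitude and in [(1 / psi')'].  The two boundary
    values count for [2 |u|].  Since [psi'] is monotone without zero, the total
    variation of [1 / psi'] is at most [1 / min |psi'|], a third [|u|]; the
    decreasing weight has total variation at most [W], the fourth [|u|], and
    the variation of [u] contributes its L^1 norm.  Everything carries the factor
    [W / (omega min |psi'|) = omega `^ (- mu) / min |psi'|].

    Two points need care.  First, [u] is differentiable everywhere with an
    integrable derivative that need not be continuous, so the classical
    fundamental theorem of calculus does not cover the integration by parts.
    What is used instead is one inequality: a function whose derivative is
    everywhere below an integrable [h] grows by at most the integral of [h]
    ([derive_le_Rintegral]).  It is obtained by majorizing [h], at a small cost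
    in the integral, by a function that dominates [h t] on a whole neighbourhood
    of each [t] ([local_majorant], in the spirit of Vitali and Caratheodory);
    the increments of the primitive of such a majorant dominate those of the
    given function locally, hence globally ([right_increment_le]).
    Second, that inequality is about real functions: the modulus of a complex
    integral is the largest real part of its rotations
    ([normRc_le_rotations]), and rotating [u] changes neither its modulus nor
    that of its derivative, so a real estimate for each rotation suffices. *)

(** * Bounding increments by the integral of a derivative *)

(** Fix the left end [t] and let [c] be the supremum of the points where the
    inequality with left end [t] holds.  It still holds at [c], because [f] is
    continuous and [phi] can only jump upwards; the hypothesis at [c] would push
    it beyond [c] unless [c = b].  No continuity of [phi] is asked for, so that
    [phi] can be the primitive of an unbounded function. *)
Lemma right_increment_le {R : realType} (a b : R) (f phi : R -> R) : a <= b ->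
    {within `[a, b], continuous f} ->
    {in `[a, b] &, {homo phi : x y / x <= y}} ->
    (forall t, t \in `]a, b[ ->
      \forall s \near t^'+, f s - f t <= phi s - phi t) ->
  f b - f a <= phi b - phi a.
Proof.
rewrite le_eqVlt => /predU1P[<- _ _ _|ab cf ndphi inc]; first by rewrite !subrr.
have [cfo cfa cfb] := (continuous_within_itvP f ab).1 cf.
(* only interior left ends satisfy the local hypothesis; [a] is reached by a limit *)
have main t : a < t -> t < b -> f b - f t <= phi b - phi t.
  move=> at_ tb.
  pose S := [set s | t <= s <= b /\ f s - f t <= phi s - phi t].
  have St : S t by split; [rewrite lexx ltW|rewrite !subrr].
  have supS : has_sup S.
    split; first by exists t.
    by exists b => s [/andP[]].
  have Sle s : S s -> s <= sup S by move=> Ss; exact: (ub_le_sup supS.2).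
  set c := sup S in Sle.
  have tc : t <= c by exact: Sle.
  have cb : c <= b by apply: ge_sup; [exists t|move=> s [/andP[]]].
  have Sc : S c.
    split; first by rewrite tc.
    have fc : f x @[x --> c^'-] --> f c.
      move: cb; rewrite le_eqVlt => /predU1P[->//|cb].
      apply: cvg_at_left_filter; apply: cfo.
      by rewrite in_itv/= cb (lt_le_trans at_).
    apply/ler_addgt0Pl => e e0.
    move/cvgrPdist_le : fc => /(_ e e0) [d /= d0 dP].
    have [s Ss cds] := sup_adherent d0 supS.
    have := Sle s Ss; rewrite le_eqVlt => /predU1P[<-|sc].
      by case: Ss => _ /le_trans; apply; rewrite ler_wpDl// ltW.
    have /dP/(_ sc)/ler_normlP[_ fcs] : ball c d s.
      by rewrite /ball/= ltr_distlC cds ltr_pwDr ?(ltW sc)//= (lt_trans sc)// ltrDl.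
    case: Ss => /andP[ts sb] H.
    have := ndphi s c; rewrite !in_itv/= sb cb (ltW sc) (le_trans (ltW at_) ts)/=.
    rewrite (le_trans (ltW at_) tc) => /(_ isT isT isT).
    by move: H; lra.
  move: cb; rewrite le_eqVlt => /predU1P[<-|cb]; first exact: Sc.2.
  have := inc c; rewrite in_itv/= cb (lt_le_trans at_ tc) => /(_ isT) incc.
  have [s [cs sb Hs]] : exists s, [/\ c < s, s < b & f s - f c <= phi s - phi c].
    near c^'+ => s; exists s; split.
    - by near: s; exact: nbhs_right_gt.
    - by near: s; exact: nbhs_right_lt.
    - by near: s.
  suff /Sle : S s by rewrite leNgt cs.
  split; first by rewrite (ltW sb) (le_trans tc (ltW cs)).
  by case: Sc => _; move: Hs; lra.
have cvga : f b - f x @[x --> a^'+] --> f b - f a by apply: cvgB => //; exact: cvg_cst.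
apply: (cvgr_to_le cvga).
near=> t.
have at_ : a < t by near: t; exact: nbhs_right_gt.
have tb : t < b by near: t; exact: nbhs_right_lt.
apply: (le_trans (main t at_ tb)); rewrite lerB//.
by apply: ndphi; rewrite ?in_itv/= ?lexx ?ltW.
Unshelve. all: by end_near. Qed.

(** Cut [D] into level sets [E k] on which rounding [h] up gives the constant
    [c k], enclose each in an open set [V k] only slightly larger, and take for
    [g] the sum over [k] of [c k] times the indicator of [V k].  Openness of
    [V k] makes the bound valid around each point. *)
Lemma local_majorant {R : realType} (D : set R) (h : R -> R) (e : R) :
    measurable D -> (leb D < +oo)%E ->
    measurable_fun D h -> (forall t, D t -> 0 <= h t) -> 0 < e ->
  exists g : R -> \bar R, [/\ measurable_fun setT g,
    forall t, (0 <= g t)%E,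
    forall t, D t -> \forall s \near t, ((h t)%:E <= g s)%E &
    (\int[leb]_t g t <=
     \int[leb]_(t in D) (h t)%:E + e%:E)%E].
Proof.
move=> mD Doo mh h0 e0.
pose l := fine (leb D); have l0 : 0 <= l by exact: fine_ge0.
have lE : leb D = l%:E by rewrite fineK// ge0_fin_numE.
(* rounding up costs [eta * l], the enlarged level sets cost [eta] *)
pose eta := e / (l + 1); have eta0 : 0 < eta by rewrite divr_gt0// ltr_wpDl.
pose E k := D `&` h @^-1` `[k%:R * eta, k.+1%:R * eta[.
have mE k : measurable (E k) by exact: mh.
have ED k : E k `<=` D by move=> t [].
have Eoo k : (leb (E k) < +oo)%E.
  by apply: le_lt_trans Doo; apply: le_measure; rewrite ?inE//; exact: mE.
pose c k : R := k.+1%:R * eta; have c0 k : 0 < c k by rewrite mulr_gt0.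
(* excess measure allowed for [V k], so that step [k] costs [eta / 2 ^ k.+1] *)
pose d k : R := eta / (2 ^ k.+1)%:R / c k.
have d0 k : 0 < d k.
  by apply: divr_gt0 (c0 k); apply: divr_gt0; rewrite // ltr0n expn_gt0.
have [V VP] := choice (fun k => lebesgue_regularity_outer (mE k) (Eoo k) (d0 k)).
have oV k : open (V k) by case: (VP k).
have EV k : E k `<=` V k by case: (VP k).
have VE k : (leb (V k `\` E k) < (d k)%:E)%E by case: (VP k).
have mV k : measurable (V k) by apply: open_measurable; exact: oV.
pose T k t : \bar R := ((c k)%:E * (\1_(V k) t)%:E)%E.
have T0 k t : (0 <= T k t)%E by rewrite mule_ge0 ?lee_fin ?indicE ?(ltW (c0 k)).
have mI k : measurable_fun setT (fun t : R => (\1_(V k) t)%:E : \bar R).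
  by apply/measurable_EFinP; exact: measurable_indic.
have iI k : (\int[leb]_t (\1_(V k) t)%:E = leb (V k))%E.
  have := integral_indic leb measurableT (mV k).
  by rewrite (setIT (V k)).
have mT k : measurable_fun setT (T k).
  by apply: measurable_funeM; exact: mI.
exists (fun t => \sum_(0 <= k <oo) T k t)%E; split.
- by apply: ge0_emeasurable_sum => // k t _ _; exact: T0.
- by move=> t; apply: nneseries_ge0 => k _ _; exact: T0.
- move=> t Dt; pose k := Num.trunc (h t / eta).
  have Et : E k t.
    split=> //=; rewrite in_itv/= -ler_pdivlMr// -ltr_pdivrMr//.
    by apply: truncn_itv; rewrite divr_ge0 ?h0// ltW.
  have Vt : nbhs t (V k) by apply: open_nbhs_nbhs; split=> //; exact: EV.
  apply: filterS Vt => s Vs.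
  rewrite (@nneseriesD1 _ _ k)//.
  rewrite /T indicE mem_set// mule1 -[leLHS]adde0 leeD//.
    by rewrite lee_fin; case: Et => _ /=; rewrite in_itv/= => /andP[_ /ltW].
  by apply: nneseries_ge0 => j _ _; exact: T0.
rewrite integral_nneseries//.
have trivE : trivIset setT E.
  have step i j t : E i t -> E j t -> (i <= j)%N.
    move=> [_ /=] + [_ /=]; rewrite !in_itv/= => /andP[it _] /andP[_ tj].
    by have := le_lt_trans it tj; rewrite ltr_pM2r// ltr_nat.
  by move=> i j _ _ [t [Eit Ejt]]; apply/eqP; rewrite eqn_leq !(step _ _ t).
have mhe A : measurable A -> A `<=` D ->
    measurable_fun A (fun t => (h t + eta)%:E).
  move=> mA AD; apply/measurable_EFinP; apply: measurable_funD => //.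
  exact: measurable_funS mh.
have intT k : (\int[leb]_t T k t <=
    \int[leb]_(t in E k) (h t + eta)%:E + (eta / (2 ^ k.+1)%:R)%:E)%E.
  rewrite ge0_integralZl_EFin ?(ltW (c0 k))//; last exact: mI.
  rewrite iI.
  have -> : leb (V k) = (leb (E k) + leb (V k `\` E k))%E.
    rewrite -[in LHS](setDUK (EV k)) measureU; last by rewrite setDIK.
    - by [].
    - exact: mE.
    - exact: (measurableD (mV k) (mE k)).
  rewrite ge0_muleDr// leeD//.
    rewrite -integral_cst; last exact: mE.
    apply: ge0_le_integral => /=.
    - exact: mE.
    - by move=> t _; rewrite lee_fin (ltW (c0 k)).
    - exact: measurable_cst.
    - exact: mhe.
    - move=> t [_ /=]; rewrite in_itv/= => /andP[ht _].
      by rewrite lee_fin /c -natr1 mulrDl mul1r lerD2r.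
  rewrite (le_trans (lee_wpmul2l _ (ltW (VE k))))//; first by rewrite lee_fin ltW.
  by rewrite -EFinM lee_fin /d mulrC divfK// gt_eqF.
have he0 t : D t -> (0 <= (h t + eta)%:E)%E.
  by move=> Dt; rewrite lee_fin addr_ge0 ?h0 ?ltW.
apply: (@le_trans _ _ (\sum_(0 <= k <oo) (\int[leb]_(t in E k) (h t + eta)%:E +
    (eta / (2 ^ k.+1)%:R)%:E))%E).
  apply: lee_nneseries => [k _ _|k _]; last exact: intT.
  by apply: integral_ge0 => t _; exact: T0.
rewrite nneseriesD//; last 2 first.
- by move=> k _ _; apply: integral_ge0 => t /ED; exact: he0.
- by move=> k _ _; rewrite lee_fin divr_ge0// ltW.
rewrite -ge0_integral_bigcup//; last 2 first.
- by apply: mhe; [exact: bigcupT_measurable|move=> t [k _ /ED]].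
- by move=> t [k _ /ED]; exact: he0.
apply: (@le_trans _ _ (\int[leb]_(t in D) (h t + eta)%:E + eta%:E)%E).
  apply: leeD; last by apply: epsilon_trick0; exact: ltW.
  apply: ge0_subset_integral => //; first exact: bigcupT_measurable.
  - exact: mhe.
  - by move=> t [k _ /ED].
have mhE : measurable_fun D (fun t => (h t)%:E) by apply/measurable_EFinP.
have -> : (\int[leb]_(t in D) (h t + eta)%:E =
    \int[leb]_(t in D) (h t)%:E + eta%:E * leb D)%E.
  rewrite -integral_cst// -ge0_integralD//.
  by move=> t _; rewrite lee_fin (ltW eta0).
rewrite -addeA leeD2l//.
rewrite lE -EFinM -EFinD lee_fin /eta -[X in _ + X]mulr1 -mulrDr.
by rewrite divfK// gt_eqF// ltr_wpDl.
Qed.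

Lemma is_derive1_slopeP {R : realType} (f : R -> R) (x l : R) :
  is_derive x 1 f l <-> (f y - f x) / (y - x) @[y --> x^'] --> l.
Proof.
have -> : is_derive x 1 f l <->
    h^-1 *: ((f \o shift x) (h *: 1) - f x) @[h --> 0^'] --> l.
  split; first by move=> [+ <-].
  by move=> fl; split; [apply/cvg_ex; exists l|exact: cvg_lim fl].
split=> /cvgrPdist_lt fl; apply/cvgrPdist_lt => e /fl [d /= d0 dP].
  exists d => //= y xyd yx; rewrite mulrC.
  have := dP (y - x); rewrite /= scaler1 subrK sub0r normrN distrC => /(_ xyd).
  by apply; rewrite subr_eq0.
exists d => //= h hd h0; rewrite scaler1.
have := dP (h + x); rewrite /= addrK opprD addrCA subrr addr0 normrN.
rewrite /= sub0r normrN in hd; move=> /(_ hd); rewrite mulrC; apply.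
by rewrite -subr_eq0 addrK.
Qed.

Lemma slope_near_right {R : realType} (f : R -> R) (t l k : R) :
  is_derive t 1 f l -> l < k -> \forall s \near t^'+, f s - f t <= k * (s - t).
Proof.
move=> /is_derive1_slopeP /cvgrPdist_lt fl lk.
have := fl (k - l); rewrite subr_gt0 => /(_ lk) [d /= d0 dP].
exists d => //= s tsd ts; rewrite -ler_pdivrMr ?subr_gt0//.
have := dP s tsd; rewrite (gt_eqF ts) => /(_ isT).
by rewrite ltr_distl => /andP[+ _]; rewrite ltrBlDr (addrC l) subrK => /ltW.
Qed.

Lemma integral_itv_oc_cat {R : realType} (g : R -> \bar R) (a t s : R) :
  measurable_fun setT g -> (forall x, 0 <= g x)%E -> a <= t -> t <= s ->
  (\int[leb]_(x in `]a, s]) g x =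
   \int[leb]_(x in `]a, t]) g x + \int[leb]_(x in `]t, s]) g x)%E.
Proof.
move=> mg g0 at_ ts.
rewrite (@itv_bndbnd_setU _ _ _ (BRight t)) ?bnd_simp// ge0_integral_setU//.
  exact: measurable_funTS.
apply/disj_setPS => x [/=]; rewrite !in_itv/= => /andP[_ xt] /andP[tx _].
by move: tx; rewrite ltNge xt.
Qed.

(** Compare [f] with the primitive of a local majorant of [h], tilted by a small
    slope that absorbs the error in the difference quotients of [f]. *)
Lemma ge0_derive_le_integral {R : realType} (a b : R) (f df h : R -> R) :
    a <= b -> {within `[a, b], continuous f} ->
    (forall t, t \in `]a, b[ -> is_derive t 1 f (df t)) ->
    (forall t, t \in `]a, b[ -> df t <= h t) ->
    (forall t, t \in `]a, b[ -> 0 <= h t) ->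
    leb.-integrable `]a, b[ (EFin \o h) ->
  ((f b - f a)%:E <= \int[leb]_(t in `]a, b[) (h t)%:E)%E.
Proof.
move=> ab cf dfP dfh h0 ih.
have ihoo : (\int[leb]_(t in `]a, b[) (h t)%:E)%E \is a fin_num.
  exact: (integrable_fin_num _ ih).
rewrite -(fineK ihoo) lee_fin; apply/ler_addgt0Pr => e' e'0.
(* [e] is spent once on the majorant and once per unit length on the tilt *)
pose e := e' / (1 + (b - a)).
have ba0 : 0 <= b - a by rewrite subr_ge0.
have e0 : 0 < e by rewrite divr_gt0// ltr_pwDl.
have loo : (leb `]a, b[ < +oo)%E.
  by rewrite lebesgue_measure_itv/=; case: ifPn => _; rewrite ?ltry// -EFinB ltry.
have mh : measurable_fun `]a, b[ h by case/integrableP: ih => /measurable_EFinP.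
have [g [mg g0 hg ig]] :=
  local_majorant _ _ _ (measurable_itv `]a, b[) loo mh h0 e0.
pose G (A : set R) := (\int[leb]_(x in A) g x)%E.
have Goo A : measurable A -> (G A <= G setT)%E.
  by move=> mA; apply: ge0_subset_integral.
have GT : (G setT < +oo)%E.
  by apply: (le_lt_trans ig); rewrite -(fineK ihoo) -EFinD ltry.
have G0 A : (0 <= G A)%E by apply: integral_ge0.
have Gfin A : measurable A -> G A \is a fin_num.
  by move=> mA; rewrite ge0_fin_numE// (le_lt_trans _ GT)// Goo.
pose phi t := fine (G `]a, t]%classic) + e * t.
have phiB t s : a <= t -> t <= s ->
    phi s - phi t = fine (G `]t, s]%classic) + e * (s - t).
  move=> at_ ts; rewrite /phi /G (integral_itv_oc_cat g a t s mg g0 at_ ts).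
  by rewrite fineD; [lra|exact: Gfin|exact: Gfin].
have -> : e' = e + e * (b - a).
  by rewrite /e -[X in X + _]mulr1 -mulrDr divfK// gt_eqF// ltr_pwDl.
have := @right_increment_le R a b f phi ab cf _ _.
rewrite phiB// => /(_ _ _)/le_trans; apply.
- move=> x y; rewrite !in_itv/= => /andP[ax _] _ xy.
  by rewrite -subr_ge0 phiB// addr_ge0 ?fine_ge0// mulr_ge0 ?subr_ge0// ltW.
- move=> t tab; have /andP[at_ tb] : a < t < b by rewrite in_itv/= in tab.
  have /(hg t)[r /= r0 rP] : `]a, b[%classic t by [].
  near=> s.
  have ts : t < s by near: s; exact: nbhs_right_gt.
  have str : s < t + r by near: s; apply: nbhs_right_lt; rewrite ltrDl.
  rewrite phiB ?(ltW at_) ?(ltW ts)//.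
  apply: (@le_trans _ _ ((h t + e) * (s - t))).
    near: s; apply: slope_near_right; first exact: dfP.
    by rewrite (le_lt_trans (dfh t tab))// ltrDl.
  rewrite mulrDl lerD2r -lee_fin fineK ?Gfin// EFinM.
  have -> : (s - t)%:E = leb `]t, s] by rewrite lebesgue_measure_itv/= lte_fin ts.
  rewrite -integral_cst//; apply: ge0_le_integral => //=.
  + by move=> x _; rewrite lee_fin h0.
  + exact: measurable_funTS.
  + move=> x; rewrite in_itv/= => /andP[tx xs]; apply: rP => /=.
    by rewrite ltr_distlC; apply/andP; split; lra.
- rewrite addrA lerD2r -lee_fin fineK ?Gfin// EFinD fineK//.
  exact: le_trans (Goo _ _) ig.
Unshelve. all: by end_near. Qed.

(** Adding a linear function to [f] reduces to a nonnegative [h].  Integration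
    by parts against an amplitude with a discontinuous derivative goes through
    this inequality. *)
Lemma derive_le_Rintegral {R : realType} (a b K : R) (f df h : R -> R) :
    a <= b -> {within `[a, b], continuous f} ->
    (forall t, t \in `]a, b[ -> is_derive t 1 f (df t)) ->
    (forall t, t \in `]a, b[ -> df t <= h t) ->
    (forall t, t \in `]a, b[ -> - K <= h t) ->
    leb.-integrable `]a, b[ (EFin \o h) ->
  f b - f a <= \int[leb]_(t in `]a, b[) h t.
Proof.
move=> ab cf dfP dfh hK ih.
have iK : leb.-integrable `]a, b[ (EFin \o cst K).
  apply: (@integrableS _ _ _ leb `[a, b]) => //; first exact: subset_itv_oo_cc.
  apply: continuous_compact_integrable; first exact: segment_compact.
  by move=> x; exact: cvg_cst.
have ihK : leb.-integrable `]a, b[ (EFin \o (fun t => h t + K)).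
  by apply: eq_integrable (integrableD _ ih iK).
have lebE : fine (leb `]a, b[) = b - a.
  rewrite lebesgue_measure_itv/= lte_fin; case: ltP => // ba.
  by apply/esym/eqP; rewrite subr_eq0 eq_le ba ab.
have := ge0_derive_le_integral a b (fun t => f t + K * t) (fun t => df t + K)
  (fun t => h t + K) ab _ _ _ _ ihK.
rewrite -[X in (_ <= X)%E]fineK; last exact: (integrable_fin_num _ ihK).
rewrite lee_fin -/(Rintegral _ _ _) RintegralD// Rintegral_cst// lebE.
move=> H; suff : f b + K * b - (f a + K * a) <=
    \int[leb]_(x in `]a, b[) h x + K * (b - a) by lra.
apply: H.
- have cK : {within `[a, b], continuous (fun t => K * t)}.
    by apply: continuous_subspaceT => x; exact: mulrl_continuous.
  by move=> x; apply: cvgD; [exact: cf|exact: cK].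
- move=> t /dfP tf; apply: is_deriveD.
  by apply: is_derive_eq; rewrite /GRing.scale/= mulr1.
- by move=> t /dfh; rewrite lerD2r.
- by move=> t /hK; rewrite -lerBlDr sub0r.
Qed.

(** * The power weight *)

Lemma is_derive_powR_shift {R : realType} (c a p : R) : c < p ->
  is_derive p 1 (fun q => (q - c) `^ a) (a * (p - c) `^ (a - 1)).
Proof.
move=> cp; have pc0 : 0 < p - c by rewrite subr_gt0.
have dpow := is_derive1_powR a pc0.
have dsub : is_derive p 1 (fun q => q - c) 1.
  by apply: is_derive_eq; rewrite oppr0 addr0.
rewrite -[a * _]mulr1.
exact: (@is_derive1_comp _ ((@powR R)^~ a) (fun q => q - c) p _ _ dpow dsub).
Qed.

Lemma is_derive_continuous {R : realType} (f : R -> R) (x l : R) :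
  is_derive x 1 f l -> {for x, continuous f}.
Proof.
by move=> [df _]; apply: differentiable_continuous; exact/derivable1_diffP.
Qed.

Lemma measurable_powR_shift {R : realType} (c a : R) (D : set R) :
  measurable_fun D (fun q => (q - c) `^ a).
Proof.
apply: measurableT_comp (measurable_powR a) _; exact: measurable_funB.
Qed.

Lemma integral_powR_shift {R : realType} (c e a b : R) : c < a -> a < b ->
  (\int[leb]_(p in `[a, b]) (e * (p - c) `^ (e - 1))%:E
     = ((b - c) `^ e - (a - c) `^ e)%:E)%E.
Proof.
move=> ca ab.
have dW p : a <= p ->
    is_derive p 1 (fun p => (p - c) `^ e) (e * (p - c) `^ (e - 1)).
  by move=> ap; apply: is_derive_powR_shift; exact: lt_le_trans ap.
rewrite (@continuous_FTC2 _ _ (fun p => (p - c) `^ e))//.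
- apply: continuous_in_subspaceT => p; rewrite inE/= in_itv/= => /andP[ap _].
  apply: cvgM; first exact: cvg_cst.
  apply: is_derive_continuous (is_derive_powR_shift _ _ _ _).
  exact: lt_le_trans ap.
- split.
  + by move=> p; rewrite in_itv/= => /andP[/ltW/dW[]].
  + apply: cvg_at_right_filter.
    exact: is_derive_continuous (dW _ (lexx _)).
  + apply: cvg_at_left_filter.
    exact: is_derive_continuous (dW _ (ltW ab)).
- move=> p; rewrite in_itv/= => /andP[ap _]; rewrite derive1E.
  by have [] := dW p (ltW ap).
Qed.

(** The weight is unbounded near [c] when [mu < 1]: integrate it from
    [c + 1 / n.+1], where it is continuous, and pass to the limit. *)
Lemma integral_powR_shift_le {R : realType} (c x mu : R) : 0 < mu -> c <= x ->
  (\int[leb]_(p in `]c, x]) ((p - c) `^ (mu - 1))%:E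
     <= ((x - c) `^ mu / mu)%:E)%E.
Proof.
move=> mu0 cx; pose w p := (p - c) `^ (mu - 1).
pose a n : R := c + n.+1%:R^-1.
have ca n : c < a n by rewrite ltrDl.
have -> : `]c, x]%classic = \bigcup_n `]a n, x]%classic.
  apply/seteqP; split => p /=; rewrite in_itv/=.
    move=> /andP[cp px].
    exists (Num.trunc (p - c)^-1) => //=; rewrite in_itv/= px andbT.
    rewrite /a -ltrBrDl invf_plt ?posrE ?subr_gt0// .
    have := @truncn_itv _ (p - c)^-1.
    by rewrite invr_ge0 subr_ge0 (ltW cp) => /(_ isT)/andP[].
  move=> [n _]; rewrite /= in_itv/= => /andP[anp ->].
  by rewrite (lt_trans (ca n)).
have cvgw : (\int[leb]_(p in `]a n, x]) (w p)%:E)%E @[n --> \oo] -->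
    (\int[leb]_(p in \bigcup_n `]a n, x]%classic) (w p)%:E)%E.
  apply: ge0_nondecreasing_set_cvg_integral => //.
  - move=> n m nm; apply/subsetPset/subset_itvr; rewrite bnd_simp lerD2l.
    by rewrite lef_pV2 ?posrE// ler_nat.
  - by move=> n; apply/measurable_EFinP; exact: measurable_powR_shift.
  - by move=> n p _; rewrite lee_fin powR_ge0.
apply: (cvge_to_le cvgw).
apply: nearW => n.
have [anx|anx] := ltP (a n) x; last first.
  by rewrite set_itv_ge ?bnd_simp -?leNgt// integral_set0 lee_fin divr_ge0 ?powR_ge0 ?ltW.
apply: (@le_trans _ _ (\int[leb]_(p in `[a n, x]) (w p)%:E)%E).
  apply: ge0_subset_integral => //.
  - by apply/measurable_EFinP; exact: measurable_powR_shift.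
  - by move=> p _; rewrite lee_fin powR_ge0.
  - exact: subset_itv_oc_cc.
rewrite (_ : \int[leb]_(p in `[a n, x]) (w p)%:E =
    mu^-1%:E * \int[leb]_(p in `[a n, x]) (mu * w p)%:E)%E; last first.
  rewrite -ge0_integralZl_EFin ?invr_ge0 ?(ltW mu0)//.
  - by apply: eq_integral => p _; rewrite -EFinM mulKf// gt_eqF.
  - by move=> p _; rewrite lee_fin mulr_ge0 ?powR_ge0 ?ltW.
  - apply/measurable_EFinP; apply: measurable_funM => //.
    exact: measurable_powR_shift.
rewrite integral_powR_shift// -EFinM lee_fin [leRHS]mulrC.
by rewrite ler_pM2l ?invr_gt0// gerBl powR_ge0.
Qed.

Lemma integrable_powR_shift {R : realType} (c x mu : R) : 0 < mu -> c <= x ->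
  leb.-integrable `]c, x] (EFin \o (fun p => (p - c) `^ (mu - 1))).
Proof.
move=> mu0 cx; apply/integrableP; split.
  by apply/measurable_EFinP; exact: measurable_powR_shift.
under eq_integral do rewrite /= ger0_norm ?powR_ge0//.
exact: le_lt_trans (integral_powR_shift_le _ _ _ mu0 cx) (ltry _).
Qed.

Lemma integrable_powR_shiftM {R : realType} (c x mu L : R) (f : R -> R) :
    0 < mu -> c <= x -> {within `[c, x], continuous f} ->
    (forall p, p \in `[c, x] -> `|f p| <= L) ->
  leb.-integrable `]c, x] (EFin \o (fun p => (p - c) `^ (mu - 1) * f p)).
Proof.
move=> mu0 cx cf fL.
have L0 : 0 <= L by apply: le_trans (fL c _); rewrite ?in_itv/= ?lexx.
apply: (@le_integrable _ _ _ leb _ _ _ (EFin \o (fun p => L * (p - c) `^ (mu - 1)))) => //.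
- apply/measurable_EFinP; apply: measurable_funM.
    exact: measurable_powR_shift.
  apply: (@measurable_funS _ _ _ _ `[c, x]) => //; first exact: subset_itv_oc_cc.
  exact: subspace_continuous_measurable_fun.
- move=> p /= pcx; rewrite lee_fin normrM mulrC [leRHS]ger0_norm; last first.
    by rewrite mulr_ge0 ?powR_ge0.
  rewrite [`|_ `^ _|]ger0_norm ?powR_ge0// ler_wpM2r ?powR_ge0// fL//.
  exact: subset_itv_oc_cc.
- by apply: eq_integrable (integrableZl _ L (integrable_powR_shift _ _ _ mu0 cx)).
Qed.

Lemma Rintegral_powR_shiftM_le {R : realType} (c x mu L : R) (f : R -> R) :
    0 < mu -> c <= x -> {within `[c, x], continuous f} ->
    (forall p, p \in `[c, x] -> `|f p| <= L) ->
  \int[leb]_(p in `]c, x]) ((p - c) `^ (mu - 1) * f p) <=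
    L * ((x - c) `^ mu / mu).
Proof.
move=> mu0 cx cf fL.
have L0 : 0 <= L by apply: le_trans (fL c _); rewrite ?in_itv/= ?lexx.
have iw := integrable_powR_shift c x mu mu0 cx.
apply: (@le_trans _ _ (\int[leb]_(p in `]c, x]) (L * (p - c) `^ (mu - 1)))).
  apply: le_Rintegral => //.
  - exact: integrable_powR_shiftM fL.
  - by apply: eq_integrable (integrableZl _ L iw).
  - move=> p pcx; rewrite mulrC ler_wpM2r ?powR_ge0//.
    by rewrite (le_trans (ler_norm _))// fL//; exact: subset_itv_oc_cc.
rewrite RintegralZl// ler_wpM2l// -lee_fin fineK.
  exact: integral_powR_shift_le.
exact: (integrable_fin_num _ iw).
Qed.

Lemma le0_ler_powR {R : realType} (e a b : R) : e <= 0 -> 0 < a -> a <= b ->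
  b `^ e <= a `^ e.
Proof.
move=> e0 a0 ab; rewrite -(opprK e) powRN [leRHS]powRN lef_pV2 ?posrE ?powR_gt0//.
- by rewrite ge0_ler_powR ?oppr_ge0// nnegrE ltW// (lt_le_trans a0).
- exact: lt_le_trans ab.
Qed.

(** * Real oscillatory integrals *)

Lemma is_derive1_homo_ge0 {R : realType} (f : R -> R) (x y t l : R) :
  {in `[x, y] &, {homo f : a b / a <= b}} -> t \in `]x, y[ ->
  is_derive t 1 f l -> 0 <= l.
Proof.
move=> ndf txy /is_derive1_slopeP fl.
apply: (cvgr_to_ge fl); near=> s.
have sxy : s \in `[x, y].
  by apply: subset_itv_oo_cc; near: s; apply: nbhs_dnbhs; exact: near_in_itvoo.
have txy' : t \in `[x, y] by exact: subset_itv_oo_cc.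
have [st|ts] := leP s t.
  by rewrite mulr_le0// ?invr_le0 subr_le0// ndf.
by rewrite divr_ge0// subr_ge0 ?ndf// ltW.
Unshelve. all: by end_near. Qed.

Lemma is_derive1_nhomo_le0 {R : realType} (f : R -> R) (x y t l : R) :
  {in `[x, y] &, {homo f : a b /~ a <= b}} -> t \in `]x, y[ ->
  is_derive t 1 f l -> l <= 0.
Proof.
move=> nif txy dfl; rewrite -oppr_ge0.
apply: (@is_derive1_homo_ge0 _ (fun s => - f s) x y t) => //.
  by move=> a b axy bxy ab; rewrite lerN2 nif.
Qed.

(** By the intermediate value theorem [f] keeps its sign, so both reciprocals lie
    on the same side of [0], within distance [m^-1] of it. *)
Lemma inv_sub_le {R : realType} (x y m : R) (f : R -> R) : x <= y -> 0 < m ->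
  {within `[x, y], continuous f} -> (forall t, t \in `[x, y] -> m <= `|f t|) ->
  `|(f x)^-1 - (f y)^-1| <= m^-1.
Proof.
move=> xy m0 cf mf.
have fx : m <= `|f x| by rewrite mf// in_itv/= lexx.
have fy : m <= `|f y| by rewrite mf// in_itv/= lexx xy.
have inv_le z : m <= `|z| -> `|z^-1| <= m^-1.
  by move=> mz; rewrite normfV lef_pV2// posrE// (lt_le_trans m0).
have f0 t : t \in `[x, y] -> f t != 0.
  by move=> /mf mt; rewrite -normr_gt0 (lt_le_trans m0).
have same : (0 < f x) = (0 < f y).
  have no0 : ~ (Num.min (f x) (f y) <= 0 <= Num.max (f x) (f y)).
    by move=> /(IVT xy cf)[c /f0 /eqP].
  apply/idP/idP => h; rewrite ltNge; apply/negP => h'; apply: no0;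
    by rewrite ge_min le_max h' (ltW h) ?orbT.
have /ler_normlP[? ?] := inv_le _ fx; have /ler_normlP[? ?] := inv_le _ fy.
case: (ltP 0 (f x)) same => [fx0|fx0] /esym same.
  have := fx0; rewrite -invr_gt0 => ?; have := same; rewrite -invr_gt0 => ?.
  by apply/ler_normlP; split; lra.
have : (f x)^-1 <= 0 by rewrite invr_le0.
have : (f y)^-1 <= 0 by rewrite invr_le0 leNgt same.
by move=> ? ?; apply/ler_normlP; split; lra.
Qed.

Lemma is_derive1_inv {R : realType} (f : R -> R) (t l : R) : f t != 0 ->
  is_derive t 1 f l -> is_derive t 1 (fun u => (f u)^-1) (- (f t) ^- 2 * l).
Proof.
move=> ft0 [df <-]; apply: DeriveDef; first exact: derivableV.
exact: deriveV.
Qed.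

(** Van der Corput's first-derivative test for the real part of
    [(c1 + i c2) e^(i om psi)].  The bounds on the amplitude and on its
    derivative are stated through all the combinations
    [c1 sin r + c2 cos r]: they amount to bounds on the moduli, and apply both
    to the integrand and to its imaginary counterpart.
    In [3 * M], two units come from the boundary terms and one from the total
    variation of [1 / dpsi]. *)
Lemma oscillatory_Rintegral_le {R : realType} (x y m om M : R)
    (c1 c2 dc1 dc2 psi dpsi ddpsi k : R -> R) :
    x <= y -> 0 < m -> 0 < om ->
    {within `[x, y], continuous c1} -> {within `[x, y], continuous c2} ->
    {within `[x, y], continuous psi} -> {within `[x, y], continuous dpsi} ->
    (forall t, t \in `]x, y[ -> is_derive t 1 c1 (dc1 t)) ->
    (forall t, t \in `]x, y[ -> is_derive t 1 c2 (dc2 t)) ->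
    (forall t, t \in `]x, y[ -> is_derive t 1 psi (dpsi t)) ->
    (forall t, t \in `]x, y[ -> is_derive t 1 dpsi (ddpsi t)) ->
    (forall t, t \in `[x, y] -> m <= `|dpsi t|) ->
    monotone_on `[x, y] dpsi ->
    (forall t r, t \in `[x, y] -> `|c1 t * sin r + c2 t * cos r| <= M) ->
    (forall t r, t \in `]x, y[ -> `|dc1 t * sin r + dc2 t * cos r| <= k t) ->
    leb.-integrable `]x, y[ (EFin \o k) ->
  \int[leb]_(t in `]x, y[) (c1 t * cos (om * psi t) - c2 t * sin (om * psi t))
    <= (3 * M + \int[leb]_(t in `]x, y[) k t) / (om * m).
Proof.
move=> xy m0 om0 cc1 cc2 cpsi cdpsi dc1P dc2P dpsiP ddpsiP mdpsi mono cM dck ik.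
pose F t := c1 t * cos (om * psi t) - c2 t * sin (om * psi t).
pose H t := c1 t * sin (om * psi t) + c2 t * cos (om * psi t).
pose g t := (dpsi t)^-1.
(* a quarter turn exchanges [F] and [H] *)
have FM t : t \in `[x, y] -> `|F t| <= M.
  move=> txy; have := cM t (om * psi t + pi / 2) txy.
  by rewrite sinDpihalf cosDpihalf mulrN.
have HM t : t \in `[x, y] -> `|H t| <= M by exact: cM.
have gm t : t \in `[x, y] -> `|g t| <= m^-1.
  by move=> /mdpsi mt; rewrite normfV lef_pV2// posrE// (lt_le_trans m0).
have dpsi0 t : t \in `[x, y] -> dpsi t != 0.
  by move=> /mdpsi mt; rewrite -normr_gt0 (lt_le_trans m0).
have M0 : 0 <= M by apply: le_trans (FM x _); rewrite ?in_itv/= ?lexx.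
have oo_cc t : t \in `]x, y[ -> t \in `[x, y] by exact: subset_itv_oo_cc.
have [s [s1 sP]] : exists s : R, `|s| = 1 /\
    forall t, t \in `]x, y[ -> 0 <= s * ddpsi t.
  case: mono => [nd|ni]; [exists 1|exists (-1)].
    split=> [|t txy]; rewrite ?normr1 ?mul1r//.
    by apply: (is_derive1_homo_ge0 dpsi x y t) => //;
      [by move=> a b ax bx; apply: nd; rewrite inE|exact: ddpsiP].
  split=> [|t txy]; rewrite ?normrN1 ?mulN1r// oppr_ge0.
  by apply: (is_derive1_nhomo_le0 dpsi x y t) => //;
      [by move=> a b ax bx; apply: ni; rewrite inE|exact: ddpsiP].
have cth : {within `[x, y], continuous (fun t => om * psi t)}.
  by move=> t; apply: cvgM; [exact: cvg_cst|exact: cpsi].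
have cS : {within `[x, y], continuous (fun t => sin (om * psi t))}.
  by move=> t; apply: continuous_comp; [exact: cth|exact: continuous_sin].
have cC : {within `[x, y], continuous (fun t => cos (om * psi t))}.
  by move=> t; apply: continuous_comp; [exact: cth|exact: continuous_cos].
have cF : {within `[x, y], continuous F}.
  by move=> t; apply: cvgB; apply: cvgM; [exact: cc1|exact: cC|exact: cc2|exact: cS].
have cH : {within `[x, y], continuous H}.
  by move=> t; apply: cvgD; apply: cvgM; [exact: cc1|exact: cS|exact: cc2|exact: cC].
have cg : {within `[x, y], continuous g}.
  rewrite continuous_subspace_in => t; rewrite inE => txy.
  by apply: cvgV; [exact: dpsi0|exact: cdpsi].
pose dH t := dc1 t * sin (om * psi t) + dc2 t * cos (om * psi t) +
  om * dpsi t * F t.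
pose dg t := - (dpsi t) ^- 2 * ddpsi t.
have dgP t : t \in `]x, y[ -> is_derive t 1 g (dg t).
  by move=> txy; apply: is_derive1_inv; [exact/dpsi0/oo_cc|exact: ddpsiP].
have dHP t : t \in `]x, y[ -> is_derive t 1 H (dH t).
  move=> txy; have d1 := dc1P t txy; have d2 := dc2P t txy.
  have dth : is_derive t 1 (fun t => om * psi t) (om * dpsi t).
    have dp := dpsiP t txy; exact: is_deriveZ.
  have dS := @is_derive1_comp _ sin _ t _ _ (is_derive_sin _) dth.
  have dC := @is_derive1_comp _ cos _ t _ _ (is_derive_cos _) dth.
  have D := is_deriveD (is_deriveM d1 dS) (is_deriveM d2 dC).
  apply: (is_derive_eq D); rewrite /GRing.scale/= /dH /F; ring.
(* [phi] is minus the primitive suggested by integration by parts, corrected by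
   a multiple of [g] whose derivative cancels the term in [(1 / dpsi)'] *)
pose phi t := - (om^-1 * (g t * H t)) + M / om * (s * g t).
pose dphi t := - (om^-1 * (g t * dH t + H t * dg t)) + M / om * (s * dg t).
have dphiP t : t \in `]x, y[ -> is_derive t 1 phi (dphi t).
  move=> txy; have d1 := dgP t txy; have d2 := dHP t txy.
  have D := is_deriveD (is_deriveN (is_deriveZ om^-1 (is_deriveM d1 d2)))
    (is_deriveZ (M / om) (is_deriveZ s d1)).
  by apply: (is_derive_eq D); rewrite /GRing.scale/= /dphi; ring.
have cphi : {within `[x, y], continuous phi}.
  move=> t; apply: cvgD.
    apply: cvgN; apply: cvgM; first exact: cvg_cst.
    by apply: cvgM; [exact: cg|exact: cH].
  apply: cvgM; first exact: cvg_cst.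
  by apply: cvgM; [exact: cvg_cst|exact: cg].
pose h t := (om * m)^-1 * k t - F t.
have omm0 : 0 < (om * m)^-1 by rewrite invr_gt0 mulr_gt0.
have dphih t : t \in `]x, y[ -> dphi t <= h t.
  move=> txy; have txy' := oo_cc t txy.
  set A := dc1 t * sin (om * psi t) + dc2 t * cos (om * psi t).
  have gA : - (g t * A) <= m^-1 * k t.
    rewrite (le_trans (ler_norm _))// normrN normrM.
    by rewrite ler_pM ?gm// dck.
  (* [1 / dpsi] varies in the direction opposite to [dpsi], hence the sign *)
  have sdg : M * (s * dg t) = - (M * `|dg t|).
    rewrite -[`|dg t|]mul1r -s1 -normrM ler0_norm ?mulrN ?opprK//.
    by rewrite /dg mulrCA mulNr oppr_le0 mulr_ge0 ?sP// invr_ge0 sqr_ge0.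
  have Hdg : - (H t * dg t) + M * (s * dg t) <= 0.
    rewrite sdg subr_le0 (le_trans (ler_norm _))// normrN normrM.
    by rewrite ler_wpM2r// HM.
  have -> : dphi t = om^-1 * (- (g t * A) + (- (H t * dg t) + M * (s * dg t)))
      - (om^-1 * om) * (dpsi t * g t) * F t by rewrite /dphi /dH -/A; ring.
  rewrite mulVf ?gt_eqF// mulfV ?dpsi0// !mul1r lerD2r.
  by rewrite invfM -mulrA ler_pM2l ?invr_gt0// -[leRHS]addr0 lerD.
have hM t : t \in `]x, y[ -> - M <= h t.
  move=> txy; have /ler_normlP[_ FMt] := FM t (oo_cc t txy).
  have k0 : 0 <= (om * m)^-1 * k t.
    by rewrite mulr_ge0 ?(ltW omm0)//; exact: le_trans (dck t 0 txy).
  by rewrite /h; lra.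
have iF : leb.-integrable `]x, y[ (EFin \o F).
  apply: (@integrableS _ _ _ leb `[x, y]) => //.
  by apply: continuous_compact_integrable => //; exact: segment_compact.
have ikm : leb.-integrable `]x, y[ (EFin \o (fun t => (om * m)^-1 * k t)).
  by apply: eq_integrable (integrableZl _ (om * m)^-1 ik).
have ih : leb.-integrable `]x, y[ (EFin \o h).
  by apply: eq_integrable (integrableB _ ikm iF).
have := derive_le_Rintegral x y M phi dphi h xy cphi dphiP dphih hM ih.
rewrite RintegralB// RintegralZl// -/F => main.
have gH t : t \in `[x, y] -> `|g t * H t| <= m^-1 * M.
  by move=> txy; rewrite normrM ler_pM ?gm ?HM.
have xx : x \in `[x, y] by rewrite in_itv/= lexx.
have yy : y \in `[x, y] by rewrite in_itv/= lexx xy.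
have /ler_normlP[gHx _] := gH x xx; have /ler_normlP[_ gHy] := gH y yy.
have sg : s * (g x - g y) <= m^-1.
  rewrite (le_trans (ler_norm _))// normrM s1 mul1r.
  exact: inv_sub_le.
have phixy : - (phi y - phi x) <= 3 * M * (om * m)^-1.
  have -> : 3 * M * (om * m)^-1 = om^-1 * (3 * (m^-1 * M)) by rewrite invfM; ring.
  have -> : - (phi y - phi x) =
      om^-1 * (g y * H y - g x * H x + M * (s * (g x - g y))).
    by rewrite /phi; ring.
  rewrite ler_pM2l ?invr_gt0//.
  have : M * (s * (g x - g y)) <= m^-1 * M by rewrite mulrC ler_wpM2r.
  by lra.
rewrite mulrDl (mulrC (Rintegral _ _ _)).
by move: main phixy; set q := (om * m)^-1; lra.
Qed.

(** Cut at [p1 + om^-1]: left of it the integral of the weight already has the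
    size [om `^ (- mu)], right of it [oscillatory_Rintegral_le] applies with
    amplitude bounded by [W * L], where [W = om `^ (1 - mu)] is the value of the
    weight at the cut. *)
Lemma singular_oscillatory_Rintegral_le {R : realType} (p1 p2 mu m om L : R)
    (a b da db psi dpsi ddpsi k : R -> R) :
    p1 < p2 -> 0 < mu <= 1 -> 0 < m -> 0 < om ->
    {within `[p1, p2], continuous a} -> {within `[p1, p2], continuous b} ->
    {within `[p1, p2], continuous psi} -> {within `[p1, p2], continuous dpsi} ->
    (forall t, t \in `]p1, p2[ -> is_derive t 1 a (da t)) ->
    (forall t, t \in `]p1, p2[ -> is_derive t 1 b (db t)) ->
    (forall t, t \in `]p1, p2[ -> is_derive t 1 psi (dpsi t)) ->
    (forall t, t \in `]p1, p2[ -> is_derive t 1 dpsi (ddpsi t)) ->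
    (forall t, t \in `[p1, p2] -> m <= `|dpsi t|) ->
    monotone_on `[p1, p2] dpsi ->
    (forall t r, t \in `[p1, p2] -> `|a t * sin r + b t * cos r| <= L) ->
    (forall t r, t \in `]p1, p2[ -> `|da t * sin r + db t * cos r| <= k t) ->
    leb.-integrable `]p1, p2[ (EFin \o k) ->
  \int[leb]_(t in `]p1, p2]) ((t - p1) `^ (mu - 1) *
      (a t * cos (om * psi t) - b t * sin (om * psi t)))
    <= (L / mu + (4 * L + \int[leb]_(t in `]p1, p2[) k t) / m) * om `^ (- mu).
Proof.
move=> p12 /andP[mu0 mu1] m0 om0 ca cb cpsi cdpsi daP dbP dpsiP ddpsiP mdpsi mono.
move=> abL dabk ik; set D := \int[leb]_(t in _) k t.
pose f t := a t * cos (om * psi t) - b t * sin (om * psi t).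
pose w t := (t - p1) `^ (mu - 1).
pose dw t := (mu - 1) * (t - p1) `^ (mu - 1 - 1).
have k0 t : t \in `]p1, p2[ -> 0 <= k t.
  by move=> tp; exact: le_trans (dabk t 0 tp).
have D0 : 0 <= D by apply: Rintegral_ge0.
have fL t : t \in `[p1, p2] -> `|f t| <= L.
  move=> tp; have := abL t (om * psi t + pi / 2) tp.
  by rewrite sinDpihalf cosDpihalf mulrN.
have L0 : 0 <= L.
  by apply: le_trans (normr_ge0 _) (fL p1 _); rewrite in_itv/= lexx ltW.
have cth : {within `[p1, p2], continuous (fun t => om * psi t)}.
  by move=> t; apply: cvgM; [exact: cvg_cst|exact: cpsi].
have cf : {within `[p1, p2], continuous f}.
  move=> t; apply: cvgB; apply: cvgM; [exact: ca| |exact: cb|].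
    by apply: continuous_comp; [exact: cth|exact: continuous_cos].
  by apply: continuous_comp; [exact: cth|exact: continuous_sin].
have omV : om `^ (- mu) = om^-1 `^ mu by rewrite -powR_inv1 ?ltW// -powRrM mulN1r.
have [small|large] := leP (p2 - p1) om^-1.
  apply: (le_trans (Rintegral_powR_shiftM_le p1 p2 mu L f mu0 (ltW p12) cf fL)).
  rewrite (mulrDl (L / mu)) -[leLHS]addr0 lerD//; last first.
    by rewrite mulr_ge0 ?powR_ge0// divr_ge0 ?(ltW m0)// addr_ge0// mulr_ge0.
  rewrite omV mulrA mulrAC ler_wpM2l ?divr_ge0 ?(ltW mu0)//.
  by rewrite ge0_ler_powR ?nnegrE ?subr_ge0 ?invr_ge0// ltW.
pose x := p1 + om^-1.
have p1x : p1 < x by rewrite ltrDl invr_gt0.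
have xp2 : x < p2 by rewrite -ltrBrDl.
have sub t : t \in `[x, p2] -> t \in `[p1, p2].
  by rewrite !in_itv/= => /andP[/(le_trans (ltW p1x)) -> ->].
have subx t : t \in `[p1, x] -> t \in `[p1, p2].
  by rewrite !in_itv/= => /andP[-> /le_trans->] //; exact: ltW.
have subo t : t \in `]x, p2[ -> t \in `]p1, p2[.
  by rewrite !in_itv/= => /andP[/(lt_trans p1x) -> ->].
pose W := w x; have W0 : 0 < W by rewrite powR_gt0 ?subr_gt0.
have wW t : t \in `[x, p2] -> 0 < w t <= W.
  rewrite in_itv/= => /andP[xt _].
  rewrite powR_gt0 ?subr_gt0 ?(lt_le_trans p1x)//=.
  by apply: le0_ler_powR; rewrite ?subr_le0 ?subr_gt0// lerD2r.
have head : \int[leb]_(t in `]p1, x]) (w t * f t) <= L / mu * om `^ (- mu).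
  apply: le_trans (Rintegral_powR_shiftM_le p1 x mu L f mu0 (ltW p1x) _ _) _.
  - by apply: continuous_subspaceW cf => t; exact: subx.
  - by move=> t /subx; exact: fL.
  by rewrite omV /x (addrC p1) addrK mulrA mulrAC.
have tail : \int[leb]_(t in `]x, p2]) (w t * f t) <=
    (4 * L + D) / m * om `^ (- mu).
  have cw : {within `[x, p2], continuous w}.
    apply: continuous_in_subspaceT => t; rewrite inE/= in_itv/= => /andP[xt _].
    apply: is_derive_continuous (is_derive_powR_shift _ _ _ _).
    exact: lt_le_trans xt.
  have dwP t : t \in `]x, p2[ -> is_derive t 1 w (dw t).
    rewrite in_itv/= => /andP[xt _].
    by apply: is_derive_powR_shift; exact: lt_trans xt.
  have restr (g : R -> R) : {within `[p1, p2], continuous g} ->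
      {within `[x, p2], continuous g}.
    by apply: continuous_subspaceW => t; exact: sub.
  have dw0 t : dw t <= 0.
    by rewrite mulr_le0_ge0 ?powR_ge0// subr_le0.
  (* the weight decreases, so [- dw] is its absolute derivative *)
  pose kw t := - L * dw t + W * k t.
  have idwcc : leb.-integrable `[x, p2] (EFin \o dw).
    apply: continuous_compact_integrable; first exact: segment_compact.
    apply: continuous_in_subspaceT => t; rewrite inE/= in_itv/= => /andP[xt _].
    apply: cvgM; first exact: cvg_cst.
    apply: is_derive_continuous (is_derive_powR_shift _ _ _ _).
    exact: lt_le_trans xt.
  have idwoc : leb.-integrable `]x, p2] (EFin \o dw).
    by apply: integrableS idwcc => //; exact: subset_itv_oc_cc.
  have idw : leb.-integrable `]x, p2[ (EFin \o dw).
    by apply: integrableS idwcc => //; exact: subset_itv_oo_cc.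
  have intdw : \int[leb]_(t in `]x, p2[) dw t = w p2 - W.
    rewrite (Rintegral_itv_bndo_bndc idw) (Rintegral_itv_obnd_cbnd idwoc).
    by rewrite /Rintegral integral_powR_shift.
  have iL : leb.-integrable `]x, p2[ (EFin \o (fun t => - L * dw t)).
    by apply: eq_integrable (integrableZl _ (- L) idw).
  have ikx : leb.-integrable `]x, p2[ (EFin \o k).
    by apply: integrableS ik => //; exact: subo.
  have iW : leb.-integrable `]x, p2[ (EFin \o (fun t => W * k t)).
    by apply: eq_integrable (integrableZl _ W ikx).
  have ikw : leb.-integrable `]x, p2[ (EFin \o kw).
    by apply: eq_integrable (integrableD _ iL iW).
  have kwD : \int[leb]_(t in `]x, p2[) kw t <= W * (L + D).
    have -> : \int[leb]_(t in `]x, p2[) kw t =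
        - L * (w p2 - W) + W * \int[leb]_(t in `]x, p2[) k t.
      by rewrite -intdw -RintegralZl// -RintegralZl// -RintegralD.
    rewrite [leRHS]mulrDr lerD//; last first.
      rewrite ler_wpM2l ?(ltW W0)// -lee_fin !fineK; last 2 first.
      - exact: (integrable_fin_num _ ik).
      - exact: (integrable_fin_num _ ikx).
      apply: ge0_subset_integral => //.
      by case/integrableP: ik.
    rewrite mulNr -mulrN opprB mulrC ler_wpM2r// gerBl.
    by rewrite powR_ge0.
  pose c1 t := w t * a t; pose c2 t := w t * b t.
  pose dc1 t := w t * da t + a t * dw t; pose dc2 t := w t * db t + b t * dw t.
  have -> : \int[leb]_(t in `]x, p2]) (w t * f t) =
      \int[leb]_(t in `]x, p2[) (c1 t * cos (om * psi t) -
        c2 t * sin (om * psi t)).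
    rewrite -Rintegral_itv_bndo_bndc; last first.
      apply: (@integrableS _ _ _ leb `[x, p2]) => //; first exact: subset_itv_oo_cc.
      apply: continuous_compact_integrable; first exact: segment_compact.
      by move=> t; apply: cvgM; [exact: cw|exact: (restr _ cf)].
    by apply: eq_Rintegral => t _; rewrite /f /c1 /c2; ring.
  have Wom : W / om = om `^ (- mu).
    have omV0 : om^-1 != 0 by rewrite invr_eq0 gt_eqF.
    have omVge0 : 0 <= om^-1 by rewrite invr_ge0 ltW.
    rewrite omV /W /w /x (addrC p1) addrK powRD ?omV0 ?implybT//.
    by rewrite powR_inv1// invrK mulfK// gt_eqF.
  have cc1 : {within `[x, p2], continuous c1}.
    by move=> t; apply: cvgM; [exact: cw|exact: (restr _ ca)].
  have cc2 : {within `[x, p2], continuous c2}.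
    by move=> t; apply: cvgM; [exact: cw|exact: (restr _ cb)].
  have dc1P t : t \in `]x, p2[ -> is_derive t 1 c1 (dc1 t).
    by move=> tx; have d1 := dwP t tx; have d2 := daP t (subo t tx);
      exact: is_deriveM.
  have dc2P t : t \in `]x, p2[ -> is_derive t 1 c2 (dc2 t).
    by move=> tx; have d1 := dwP t tx; have d2 := dbP t (subo t tx);
      exact: is_deriveM.
  have monox : monotone_on `[x, p2] dpsi.
    by case: mono => mono; [left|right] => s t;
      rewrite !inE => /sub sp /sub tp; apply: mono; rewrite inE.
  have c_le t r : t \in `[x, p2] -> `|c1 t * sin r + c2 t * cos r| <= W * L.
    move=> tx; have /andP[wt0 wtW] := wW t tx.
    have -> : c1 t * sin r + c2 t * cos r = w t * (a t * sin r + b t * cos r).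
      by rewrite /c1 /c2; ring.
    by rewrite normrM ger0_norm ?(ltW wt0)// ler_pM ?(ltW wt0)// abL// sub.
  have dc_le t r : t \in `]x, p2[ -> `|dc1 t * sin r + dc2 t * cos r| <= kw t.
    move=> tx; have /andP[wt0 wtW] : 0 < w t <= W.
      by apply: wW; exact: subset_itv_oo_cc.
    have -> : dc1 t * sin r + dc2 t * cos r =
      dw t * (a t * sin r + b t * cos r) + w t * (da t * sin r + db t * cos r).
      by rewrite /dc1 /dc2; ring.
    rewrite (le_trans (ler_normD _ _))// /kw lerD// normrM.
      rewrite ler0_norm// mulrC mulNr -mulrN ler_wpM2r ?oppr_ge0//.
      by rewrite abL// sub//; exact: subset_itv_oo_cc.
    by rewrite ger0_norm ?(ltW wt0)// ler_pM ?(ltW wt0)// dabk// subo.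
  have := oscillatory_Rintegral_le x p2 m om (W * L) c1 c2 dc1 dc2 psi dpsi ddpsi kw
    (ltW xp2) m0 om0 cc1 cc2 (restr _ cpsi) (restr _ cdpsi) dc1P dc2P
    (fun t tx => dpsiP t (subo t tx)) (fun t tx => ddpsiP t (subo t tx))
    (fun t tx => mdpsi t (sub t tx)) monox c_le dc_le ikw.
  move=> /le_trans; apply.
  rewrite -Wom.
  have -> : (4 * L + D) / m * (W / om) = (3 * (W * L) + W * (L + D)) / (om * m).
    by rewrite invfM; ring.
  by rewrite ler_pM2r ?invr_gt0 ?mulr_gt0// lerD2l.
have iwf := integrable_powR_shiftM p1 p2 mu L f mu0 (ltW p12) cf fL.
have split : \int[leb]_(t in `]p1, p2]) (w t * f t) -
    \int[leb]_(t in `]p1, x]) (w t * f t) = \int[leb]_(t in `]x, p2]) (w t * f t).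
  by apply: (Rintegral_itvB iwf); rewrite bnd_simp ltW.
rewrite (mulrDl (L / mu)) -(subrK (\int[leb]_(t in `]p1, x]) (w t * f t))
  (\int[leb]_(t in `]p1, p2]) _)) split addrC.
exact: lerD.
Qed.

(** * Relative derivatives and minima *)

(** Near an interior point the punctured neighbourhoods relative to [A] are the
    ordinary ones. *)
Lemma is_derive_derive_within {R : realType} (A : set R) (f : R -> R) (x : R) :
  nbhs x A -> derivable_within A f x -> is_derive x 1 f (derive_within A f x).
Proof.
move=> Ax df; apply/is_derive1_slopeP; move=> B /df.
rewrite /= !nbhs_simpl /= => AB.
have xA : x^' A by exact: nbhs_dnbhs.
by apply: filterS2 xA AB => y Ay; apply.
Qed.

(** The minimum is attained by compactness, so the default value of [set_min] is
    never taken. *)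
Lemma set_min_norm {R : realType} (a b : R) (f : R -> R) : a <= b ->
    {within `[a, b], continuous f} -> (forall p, p \in `[a, b] -> f p != 0) ->
  let m := set_min [set `|f p| | p in `[a, b]] in
  0 < m /\ forall p, p \in `[a, b] -> m <= `|f p|.
Proof.
move=> ab cf f0 /=; set A := [set _ | _ in _].
have [c cab cmin] : exists2 c, c \in `[a, b] & forall t, t \in `[a, b] -> `|f c| <= `|f t|.
  apply: (@EVT_min _ (fun t => `|f t|)) => // t.
  by apply: continuous_comp; [exact: cf|exact: norm_continuous].
have [[q qab qE] lbA] : (A `&` lbound A) (set_min A).
  apply: (xgetI 0 (x := `|f c|)).
  by split; [exists c|move=> _ [t tab <-]; exact: cmin].
split; first by rewrite -qE normr_gt0 f0.
by move=> p pab; apply: lbA; exists p.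
Qed.

(** * Complex-valued functions *)

Lemma normRcE {R : realType} (z : Rcomplex R) :
  `|z| = Num.sqrt (Re z ^+ 2 + Im z ^+ 2).
Proof. by case: z. Qed.

Lemma ReRc_le {R : realType} (z : Rcomplex R) : `|Re z| <= `|z|.
Proof. by rewrite normRcE -sqrtr_sqr ler_wsqrtr// lerDl sqr_ge0. Qed.

Lemma ImRc_le {R : realType} (z : Rcomplex R) : `|Im z| <= `|z|.
Proof. by rewrite normRcE -sqrtr_sqr ler_wsqrtr// lerDr sqr_ge0. Qed.

Lemma ReRcB {R : realType} (z t : Rcomplex R) : Re (z - t) = Re z - Re t.
Proof. by case: z t => [? ?] [? ?]. Qed.
Lemma ImRcB {R : realType} (z t : Rcomplex R) : Im (z - t) = Im z - Im t.
Proof. by case: z t => [? ?] [? ?]. Qed.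
Lemma ReRcZ {R : realType} (l : R) (z : Rcomplex R) : Re (l *: z) = l * Re z.
Proof. by case: z. Qed.
Lemma ImRcZ {R : realType} (l : R) (z : Rcomplex R) : Im (l *: z) = l * Im z.
Proof. by case: z. Qed.

Lemma continuous_ReRc {R : realType} : continuous (@complex.Re R : Rcomplex R -> R).
Proof.
move=> z; apply/(cvgrPdist_lt (FF := @nbhs_filter (Rcomplex R) z)) => e e0.
apply/nbhs_ballP; exists e => //= t; rewrite -ball_normE /= => zt.
by rewrite -ReRcB (le_lt_trans (ReRc_le _)).
Qed.

Lemma continuous_ImRc {R : realType} : continuous (@complex.Im R : Rcomplex R -> R).
Proof.
move=> z; apply/(cvgrPdist_lt (FF := @nbhs_filter (Rcomplex R) z)) => e e0.
apply/nbhs_ballP; exists e => //= t; rewrite -ball_normE /= => zt.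
by rewrite -ImRcB (le_lt_trans (ImRc_le _)).
Qed.

Lemma cvg_derive1 {R : realType} (V : normedModType R) (f : R -> V) (x : R) :
  derivable f x 1 -> h^-1 *: (f (h + x) - f x) @[h --> 0^'] --> derive1 f x.
Proof.
rewrite /derivable /derive1 /=.
by under eq_fun do rewrite [_%:A]mulr1.
Qed.

Lemma is_derive1P {R : realType} (f : R -> R) (x l : R) :
  h^-1 * (f (h + x) - f x) @[h --> 0^'] --> l -> is_derive x 1 f l.
Proof.
move=> fl; have fl' : h^-1 *: ((f \o shift x) (h *: 1) - f x) @[h --> 0^'] --> l.
  by under eq_fun do rewrite /= [_%:A]mulr1.
by split; [apply/cvg_ex; exists l|exact: cvg_lim fl'].
Qed.

Lemma is_derive_ReRc {R : realType} (f : R -> Rcomplex R) (x : R) :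
  derivable f x 1 -> is_derive x 1 (fun t => Re (f t)) (Re (derive1 f x)).
Proof.
move=> /cvg_derive1 df; apply: is_derive1P.
have := cvg_comp _ _ df (@continuous_ReRc R (derive1 f x)).
by apply: cvg_trans; apply: near_eq_cvg; apply: nearW => h /=; rewrite ReRcZ ReRcB.
Qed.

Lemma is_derive_ImRc {R : realType} (f : R -> Rcomplex R) (x : R) :
  derivable f x 1 -> is_derive x 1 (fun t => Im (f t)) (Im (derive1 f x)).
Proof.
move=> /cvg_derive1 df; apply: is_derive1P.
have := cvg_comp _ _ df (@continuous_ImRc R (derive1 f x)).
by apply: cvg_trans; apply: near_eq_cvg; apply: nearW => h /=; rewrite ImRcZ ImRcB.
Qed.

(** Cauchy-Schwarz against the unit vector [(sin r, cos r)]. *)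
Lemma trig_combination_le {R : realType} (a b r : R) :
  `|a * sin r + b * cos r| <= Num.sqrt (a ^+ 2 + b ^+ 2).
Proof.
rewrite -sqrtr_sqr ler_wsqrtr//.
have -> : a ^+ 2 + b ^+ 2 = (a ^+ 2 + b ^+ 2) * (cos r ^+ 2 + sin r ^+ 2).
  by rewrite cos2Dsin2 mulr1.
rewrite -subr_ge0.
have -> : (a ^+ 2 + b ^+ 2) * (cos r ^+ 2 + sin r ^+ 2) -
    (a * sin r + b * cos r) ^+ 2 = (a * cos r - b * sin r) ^+ 2 by ring.
exact: sqr_ge0.
Qed.

Lemma cLnorm1E {R : realType} (D : set R) (f : R -> Rcomplex R) :
  cLnorm 1 D f = (\int[leb]_(x in D) (`|f x|%:E))%E.
Proof.
rewrite /cLnorm Lnorm1 [RHS]integral_mkcond; apply: eq_integral => x _.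
by rewrite !patchE; case: ifPn => _; rewrite ?abse0// abse_EFin normr_id.
Qed.

Lemma measurable_normRc {R : realType} (D : set R) (f : R -> Rcomplex R) :
  measurable D -> measurable_fun D (fun x => Re (f x)) ->
  measurable_fun D (fun x => Im (f x)) -> measurable_fun D (fun x => `|f x|).
Proof.
move=> mD mr mi; under eq_fun do rewrite normRcE.
apply: (measurableT_comp (f := @Num.sqrt R)).
  by apply: continuous_measurable_fun; exact: sqrt_continuous.
by apply: measurable_funD; apply: measurable_funX.
Qed.

Lemma normRc_le {R : realType} (z : Rcomplex R) : `|z| <= `|Re z| + `|Im z|.
Proof.
rewrite normRcE -[leRHS]ger0_norm ?addr_ge0// -[leRHS]sqrtr_sqr ler_wsqrtr//.
rewrite sqrrD !real_normK ?num_real// lerD2r lerDl.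
by rewrite mulrn_wge0// mulr_ge0.
Qed.

Lemma cintegrable_norm {R : realType} (D : set R) (f : R -> Rcomplex R) :
  measurable D -> cintegrable D f ->
  leb.-integrable D (EFin \o (fun x => `|f x|)).
Proof.
move=> mD [ir ii].
have mr : measurable_fun D (fun x => Re (f x)).
  by case/integrableP: ir => /measurable_EFinP.
have mi : measurable_fun D (fun x => Im (f x)).
  by case/integrableP: ii => /measurable_EFinP.
have isum : leb.-integrable D (fun x => `|(Re (f x))%:E| + `|(Im (f x))%:E|)%E.
  by apply: integrableD => //; exact: integrable_abse.
apply: le_integrable isum => //.
  by apply/measurable_EFinP; exact: measurable_normRc.
by move=> x Dx /=; rewrite lee_fin normr_id [leRHS]ger0_norm ?addr_ge0// normRc_le.
Qed.

(** For a continuous function the essential supremum over the open interval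
    bounds every value on the closed one: a larger value would persist on a
    nondegenerate subinterval, which is not negligible. *)
Lemma norm_le_cLnormy {R : realType} (p1 p2 p : R) (u : R -> Rcomplex R) :
  p1 < p2 -> {within `[p1, p2], continuous (fun t => `|u t|)} ->
  p \in `[p1, p2] -> (`|u p|%:E <= cLnorm +oo `]p1, p2[ u)%E.
Proof.
move=> p12 cu pp; rewrite /cLnorm unlock.
have -> : (0 < leb [set: R])%E.
  apply: (@lt_le_trans _ _ (leb `[0, 1]%classic)).
    by rewrite lebesgue_measure_itv/= lte_fin ltr01 sube0 lte_fin.
  by apply: le_measure; rewrite ?inE.
set F := (X in ess_sup _ X); rewrite leNgt; apply/negP => Fup.
have [c [Fc cup]] : exists c : R, (ess_sup leb F <= c%:E)%E /\ c < `|u p|.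
  case: (ess_sup leb F) Fup => [r| |]//; first by rewrite lte_fin; exists r.
  by move=> _; exists (`|u p| - 1); rewrite leNye gtrBl.
have Fae := ess_sup_ge leb F.
have [d d0 dP] : exists2 d, 0 < d &
    forall t, t \in `[p1, p2] -> `|p - t| < d -> c < `|u t|.
  have /subspace_continuousP/(_ p pp)/cvgrPdist_lt/(_ (`|u p| - c)) := cu.
  rewrite subr_gt0 => /(_ cup) [d /= d0 dP]; exists d => // t tp pt.
  have := dP t pt tp; rewrite ltr_distlC => /andP[+ _].
  by rewrite opprB addrC subrK.
pose a := Num.max p1 (p - d); pose b := Num.min p2 (p + d).
have ab : a < b.
  move: pp; rewrite in_itv/= => /andP[p1p pp2].
  by rewrite lt_min !gt_max; apply/andP; split; apply/andP; split; lra.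
have neg : leb.-negligible `]a, b[.
  apply: negligibleS Fae => t /=; rewrite in_itv/= lt_min gt_max.
  move=> /andP[/andP[p1t pdt] /andP[tp2 tpd]]; apply/negP; rewrite -ltNge.
  have tp : t \in `]p1, p2[ by rewrite in_itv/= p1t.
  apply: (le_lt_trans Fc); rewrite /F /= patchE mem_set//= normr_id lte_fin.
  apply: dP; first exact: subset_itv_oo_cc.
  by rewrite ltr_distlC; apply/andP; split; lra.
have : leb `]a, b[ = 0%E by apply: measure_negligible.
rewrite lebesgue_measure_itv/= lte_fin ab => /eqP.
by rewrite -EFinB eqe subr_eq0 gt_eqF.
Qed.

(** Rotate by the argument of [A + i B] itself. *)
Lemma normRc_le_rotations {R : realType} (A B K : R) : 0 <= K ->
  (forall c d, c ^+ 2 + d ^+ 2 = 1 -> c * A + d * B <= K) ->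
  `|Complex A B : Rcomplex R| <= K.
Proof.
move=> K0 AB; rewrite normRcE /=; set n := Num.sqrt _.
have n2 : n ^+ 2 = A ^+ 2 + B ^+ 2 by rewrite sqr_sqrtr// addr_ge0 ?sqr_ge0.
have [->//|n0] := eqVneq n 0.
have := AB (A / n) (B / n); rewrite !expr_div_n -mulrDl -n2 divff ?sqrf_eq0//.
move=> /(_ erefl); rewrite mulrAC [X in _ + X]mulrAC -mulrDl -!expr2 -n2.
by rewrite expr2 mulfK.
Qed.

(** * The estimate *)

Theorem theorem3p12 (R : realType) (p1 p2 mu : R) (I : set R)
    (U u : R -> Rcomplex R) (psi : R -> R)
    (hp : p1 < p2)
    (Iopen : open I) (Iitv : is_interval I) (hI : `[p1, p2] `<=` I)
    (hmu : 0 < mu <= 1)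
    (hU : regular_factor p1 p2 mu U u)
    (hpsi : class_C 2 `[p1, p2] psi)
    (hpsi0 : forall p, p \in `[p1, p2] -> derive_within `[p1, p2] psi p != 0)
    (hmono : monotone_on `[p1, p2] (derive_within `[p1, p2] psi)) :
  forall omega : R, 0 < omega ->
    (`|cintegral `]p1, p2] (fun p => U p * expi (omega * psi p))|%:E
       <= Cc p1 p2 mu u psi * (omega `^ (- mu))%:E)%E.
Proof.
move=> om om0; case: hU => UE cu du iu _; have [mu0 mu1] := andP hmu.
case: hpsi => dpsiP cpsiP.
set A := `[p1, p2]%classic in dpsiP cpsiP hpsi0 hmono *.
pose dpsi := derive_within A psi; pose ddpsi := derive_within A dpsi.
have cpsi : {within A, continuous psi} by exact: (cpsiP 0%N).
have cdpsi : {within A, continuous dpsi} by exact: (cpsiP 1%N).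
have nbhsA t : t \in `]p1, p2[ -> nbhs t A.
  move=> tp; have := near_in_itvoo tp; apply: filterS => s.
  exact: subset_itv_oo_cc.
have oo_cc t : t \in `]p1, p2[ -> t \in `[p1, p2] by exact: subset_itv_oo_cc.
have dpsi_der t : t \in `]p1, p2[ -> is_derive t 1 psi (dpsi t).
  move=> tp; apply: is_derive_derive_within; first exact: nbhsA.
  by apply: (dpsiP 0%N) => //; exact: oo_cc.
have ddpsi_der t : t \in `]p1, p2[ -> is_derive t 1 dpsi (ddpsi t).
  move=> tp; apply: is_derive_derive_within; first exact: nbhsA.
  by apply: (dpsiP 1%N) => //; exact: oo_cc.
have [m0 mP] := set_min_norm p1 p2 dpsi (ltW hp) cdpsi hpsi0.
rewrite /Cc -/A -/dpsi; set m := set_min _ in m0 mP *.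
pose u1 t := Re (u t); pose u2 t := Im (u t).
have cu1 : {within A, continuous u1}.
  by move=> t; apply: continuous_comp; [exact: cu|exact: continuous_ReRc].
have cu2 : {within A, continuous u2}.
  by move=> t; apply: continuous_comp; [exact: cu|exact: continuous_ImRc].
have cnu : {within A, continuous (fun t => `|u t|)}.
  by move=> t; apply: continuous_comp; [exact: cu|exact: norm_continuous].
(* computing with the maximum of the modulus of [u], a real number, instead of the
   extended real norm that it is bounded by *)
have [q qp qmax] : exists2 q, q \in `[p1, p2] &
    forall t, t \in `[p1, p2] -> `|u t| <= `|u q|.
  exact: (@EVT_max _ (fun t => `|u t|) p1 p2 (ltW hp) cnu).
set L := `|u q| in qmax.
have LN : (L%:E <= cLnorm +oo `]p1, p2[ u)%E by exact: norm_le_cLnormy.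
have L0 : 0 <= L by exact: normr_ge0.
pose k t := `|derive1 u t|.
have ik : leb.-integrable `]p1, p2[ (EFin \o k) by exact: cintegrable_norm.
pose D := \int[leb]_(t in `]p1, p2[) k t.
have D0 : 0 <= D by apply: Rintegral_ge0 => t _; exact: normr_ge0.
have DN : cLnorm 1 `]p1, p2[ (derive1 u) = D%:E.
  by rewrite cLnorm1E /D /Rintegral fineK//; exact: (integrable_fin_num _ ik).
pose B := (L / mu + (4 * L + D) / m) * om `^ (- mu).
have BCc : (B%:E <= ((mu^-1)%:E * cLnorm +oo `]p1, p2[ u +
    (4%:E * cLnorm +oo `]p1, p2[ u + cLnorm 1 `]p1, p2[ (derive1 u)) *
    (m^-1)%:E) * (om `^ (- mu))%:E)%E.
  rewrite DN EFinM lee_wpmul2r ?lee_fin ?powR_ge0// EFinD leeD//.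
    by rewrite mulrC EFinM lee_wpmul2l// lee_fin invr_ge0 ltW.
  rewrite EFinM lee_wpmul2r// ?lee_fin ?invr_ge0 ?(ltW m0)//.
  by rewrite EFinD leeD2r// EFinM lee_wpmul2l// lee_fin.
apply: le_trans BCc; rewrite lee_fin.
pose w t := (t - p1) `^ (mu - 1).
pose S t := sin (om * psi t); pose C t := cos (om * psi t).
pose FRe t := u1 t * C t - u2 t * S t; pose FIm t := u1 t * S t + u2 t * C t.
have -> : cintegral `]p1, p2] (fun p => U p * expi (om * psi p)) =
    Complex (\int[leb]_(t in `]p1, p2]) (w t * FRe t))
            (\int[leb]_(t in `]p1, p2]) (w t * FIm t)).
  rewrite /cintegral; congr Complex; apply: eq_Rintegral => t.
    rewrite inE => tp; rewrite UE// /FRe /u1 /u2 /C /S /w.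
    by case: (u t) => a b /=; ring.
  rewrite inE => tp; rewrite UE// /FIm /u1 /u2 /C /S /w.
  by case: (u t) => a b /=; ring.
have B0 : 0 <= B.
  rewrite mulr_ge0 ?powR_ge0// addr_ge0// divr_ge0 ?(ltW mu0) ?(ltW m0)//.
  by rewrite addr_ge0 ?mulr_ge0.
have cth : {within A, continuous (fun t => om * psi t)}.
  by move=> t; apply: cvgM; [exact: cvg_cst|exact: cpsi].
have cS : {within A, continuous S}.
  by move=> t; apply: continuous_comp; [exact: cth|exact: continuous_sin].
have cC : {within A, continuous C}.
  by move=> t; apply: continuous_comp; [exact: cth|exact: continuous_cos].
have cFRe : {within A, continuous FRe}.
  by move=> t; apply: cvgB; apply: cvgM; [exact: cu1|exact: cC|exact: cu2|exact: cS].
have cFIm : {within A, continuous FIm}.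
  by move=> t; apply: cvgD; apply: cvgM; [exact: cu1|exact: cS|exact: cu2|exact: cC].
have FReL t : t \in `[p1, p2] -> `|FRe t| <= L.
  move=> /qmax; apply: le_trans; rewrite normRcE addrC -sqrrN.
  have -> : FRe t = - u2 t * S t + u1 t * C t by rewrite /FRe; ring.
  exact: trig_combination_le.
have FImL t : t \in `[p1, p2] -> `|FIm t| <= L.
  move=> /qmax; apply: le_trans; rewrite normRcE.
  exact: trig_combination_le.
have iRe := integrable_powR_shiftM p1 p2 mu L FRe mu0 (ltW hp) cFRe FReL.
have iIm := integrable_powR_shiftM p1 p2 mu L FIm mu0 (ltW hp) cFIm FImL.
apply: normRc_le_rotations => // c d cd.
pose a t := c * u1 t + d * u2 t; pose b t := c * u2 t - d * u1 t.
have -> : c * \int[leb]_(t in `]p1, p2]) (w t * FRe t) +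
    d * \int[leb]_(t in `]p1, p2]) (w t * FIm t) =
    \int[leb]_(t in `]p1, p2]) (w t * (a t * C t - b t * S t)).
  rewrite -RintegralZl// -RintegralZl// -RintegralD//.
  - by apply: eq_Rintegral => t _; rewrite /FRe /FIm /a /b; ring.
  - by apply: eq_integrable (integrableZl _ c iRe).
  - by apply: eq_integrable (integrableZl _ d iIm).
pose da t := c * Re (derive1 u t) + d * Im (derive1 u t).
pose db t := c * Im (derive1 u t) - d * Re (derive1 u t).
have rot (z : Rcomplex R) r : `|(c * Re z + d * Im z) * sin r +
    (c * Im z - d * Re z) * cos r| <= `|z|.
  apply: le_trans (trig_combination_le _ _ _) _; rewrite normRcE.
  by rewrite -[X in _ <= Num.sqrt X]mul1r -cd ler_wsqrtr// le_eqVlt; apply/orP; left;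
    apply/eqP; ring.
have dRe t : t \in `]p1, p2[ -> is_derive t 1 u1 (Re (derive1 u t)).
  by move=> /du; exact: is_derive_ReRc.
have dIm t : t \in `]p1, p2[ -> is_derive t 1 u2 (Im (derive1 u t)).
  by move=> /du; exact: is_derive_ImRc.
have daP t : t \in `]p1, p2[ -> is_derive t 1 a (da t).
  move=> tp; have d1 := dRe t tp; have d2 := dIm t tp.
  exact: (is_deriveD (is_deriveZ c d1) (is_deriveZ d d2)).
have dbP t : t \in `]p1, p2[ -> is_derive t 1 b (db t).
  move=> tp; have d1 := dRe t tp; have d2 := dIm t tp.
  exact: (is_deriveB (is_deriveZ c d2) (is_deriveZ d d1)).
have ca : {within A, continuous a}.
  move=> t; apply: cvgD; apply: cvgM;
    [exact: cvg_cst|exact: cu1|exact: cvg_cst|exact: cu2].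
have cb : {within A, continuous b}.
  move=> t; apply: cvgB; apply: cvgM;
    [exact: cvg_cst|exact: cu2|exact: cvg_cst|exact: cu1].
exact: (singular_oscillatory_Rintegral_le p1 p2 mu m om L a b da db psi dpsi ddpsi k
  hp hmu m0 om0 ca cb cpsi cdpsi daP dbP dpsi_der ddpsi_der mP hmono
  (fun t r tp => le_trans (rot (u t) r) (qmax t tp))
  (fun t r _ => rot (derive1 u t) r) ik).
Qed.
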